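(* Let $G=\mathrm{SL}(n,\mathbf C)$ with Lie algebra $\mathfrak g=\mathfrak{sl}(n,\mathbf C)$. Define maps $\Phi_k:G\to\mathfrak g$ by $$\Phi_k(g)=g^k-\frac1n\operatorname{tr}(g^k)\cdot\mathbf 1\quad\text{for }g\in G.$$ Then $\mathfrak X(G)^{\mathrm{Ad}\,G}$ is generated (as a module over $\mathbf C[G]^{\mathrm{Ad}\,G}$) by the vector fields $\tilde\Phi_1,\dots,\tilde\Phi_{n-1}$.
   Context: $\mathfrak X(G)^{\mathrm{Ad}\,G}$ is the space of regular algebraic vector fields on $G$ invariant under conjugation by $G$, and $\mathbf C[G]^{\mathrm{Ad}\,G}$ is the algebra of regular class functions, acting by pointwise multiplication. For a regular conjugation-equivariant map $\Phi:G\to\mathfrak g$ ($\Phi(xgx^{-1})=\mathrm{Ad}(x)\Phi(g)$), $\tilde\Phi$ is the conjugation-invariant vector field $\tilde\Phi f(g)=\frac{d}{dt}f(g+tg\Phi(g))|_{t=0}$ for $f\in\mathbf C[G]$ ($f$ viewed as the restriction of a regular function on $\mathrm{GL}(n,\mathbf C)$). *)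

(* Defs.v *)
From HB Require Import structures.
From mathcomp Require Import all_boot all_order all_algebra.
From mathcomp Require Import complex.
From mathcomp Require Import(canonicals, coercions) mpoly.
From mathcomp Require Import boolp classical_sets functions reals topology normedtype derive.
Import numFieldNormedType.Exports.
Set Implicit Arguments.
Unset Strict Implicit.
Unset Printing Implicit Defensive.
Import Order.TTheory GRing.Theory Num.Theory.
Local Open Scope ring_scope.

Definition SL (K : numFieldType) (n : nat) := {g : 'M[K]_n | \det g == 1}.

Definition sl (K : numFieldType) (n : nat) := {A : 'M[K]_n | \tr A == 0}.

(* GL(n) is embedded as a closed subvariety of affine space of dimension
   n * n + 1 by the entries of a matrix and the inverse of its determinant. *)
Definition GL_coord (K : numFieldType) (n : nat) (M : 'M[K]_n)
    (i : 'I_(n * n + 1)) : K :=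
  row_mx (mxvec M) (\det M)^-1%:M 0 i.

(* Only the values of F on invertible matrices matter. *)
Definition regular_GL (K : numFieldType) (n : nat) (F : 'M[K]_n -> K) : Prop :=
  exists P : mpoly.mpoly (n * n + 1) K,
    forall M, M \in unitmx -> F M = mpoly.meval (GL_coord M) P.

Definition regular_SL (K : numFieldType) (n : nat) (f : SL K n -> K) : Prop :=
  exists2 F : 'M[K]_n -> K, regular_GL F & forall g, f g = F (val g).

Section Closure.
Variables (K : numFieldType) (n : nat).
Implicit Types (f : SL K n -> K).

Lemma SL_unitmx (g : SL K n) : val g \in unitmx.
Proof. by rewrite unitmxE (eqP (valP g)) unitr1. Qed.

Lemma regular_SLP f :
  regular_SL f <->
  exists P : mpoly.mpoly (n * n + 1) K,
    forall g, f g = mpoly.meval (GL_coord (val g)) P.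
Proof.
split=> [[F [P HP] Hf]|[P HP]].
  by exists P => g; rewrite Hf HP // SL_unitmx.
exists (fun M => mpoly.meval (GL_coord M) P) => //.
by exists P.
Qed.

Lemma regular_cst (c : K) : regular_SL (fun _ : SL K n => c).
Proof. by apply/regular_SLP; exists (mpoly.mpolyC _ c) => g; rewrite mpoly.mevalC. Qed.

Lemma regular_add f1 f2 :
  regular_SL f1 -> regular_SL f2 -> regular_SL (fun g => f1 g + f2 g).
Proof.
move=> /regular_SLP[P1 H1] /regular_SLP[P2 H2]; apply/regular_SLP.
by exists (P1 + P2) => g; rewrite mpoly.mevalD H1 H2.
Qed.

Lemma regular_mul f1 f2 :
  regular_SL f1 -> regular_SL f2 -> regular_SL (fun g => f1 g * f2 g).
Proof.
move=> /regular_SLP[P1 H1] /regular_SLP[P2 H2]; apply/regular_SLP.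
by exists (P1 * P2) => g; rewrite mpoly.mevalM H1 H2.
Qed.

Lemma regular_opp f : regular_SL f -> regular_SL (fun g => - f g).
Proof.
move=> /regular_SLP[P H]; apply/regular_SLP.
by exists (- P) => g; rewrite mpoly.mevalN H.
Qed.

Lemma eq_regular f1 f2 : f1 =1 f2 -> regular_SL f1 -> regular_SL f2.
Proof. by move=> /funext ->. Qed.

Lemma regular_sum (I : Type) (r : seq I) (P : pred I) (F : I -> SL K n -> K) :
  (forall i, regular_SL (F i)) ->
  regular_SL (fun g => \sum_(i <- r | P i) F i g).
Proof.
move=> H; elim: r => [|i r IH].
  by apply: eq_regular (regular_cst 0) => g; rewrite big_nil.
case HP: (P i).
  by apply: eq_regular (regular_add (H i) IH) => g; rewrite big_cons HP.
by apply: eq_regular IH => g; rewrite big_cons HP.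
Qed.

Lemma regular_prod (I : Type) (r : seq I) (P : pred I) (F : I -> SL K n -> K) :
  (forall i, regular_SL (F i)) ->
  regular_SL (fun g => \prod_(i <- r | P i) F i g).
Proof.
move=> H; elim: r => [|i r IH].
  by apply: eq_regular (regular_cst 1) => g; rewrite big_nil.
case HP: (P i).
  by apply: eq_regular (regular_mul (H i) IH) => g; rewrite big_cons HP.
by apply: eq_regular IH => g; rewrite big_cons HP.
Qed.

Lemma regular_exp f k : regular_SL f -> regular_SL (fun g => f g ^+ k).
Proof.
move=> H; elim: k => [|k IH]; first exact: regular_cst.
by apply: eq_regular (regular_mul H IH) => g; rewrite exprS.
Qed.

Lemma regular_entry i j : regular_SL (fun g : SL K n => val g i j).
Proof.
apply/regular_SLP.
exists (mpoly.mpolyX K (mpoly.mnm1 (lshift 1 (mxvec_index i j)))) => g.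
by rewrite mpoly.mevalXU /GL_coord row_mxEl mxvecE.
Qed.

Lemma regular_meval N (x : SL K n -> 'I_N -> K) (P : mpoly.mpoly N K) :
  (forall i, regular_SL (fun g => x g i)) ->
  regular_SL (fun g => mpoly.meval (x g) P).
Proof.
move=> Hx; apply: (@eq_regular (fun g =>
  \sum_(m <- mpoly.msupp P) mpoly.mcoeff m P * \prod_i x g i ^+ m i)).
  by move=> g; rewrite mpoly.mevalE.
apply: regular_sum => m; apply: regular_mul; first exact: regular_cst.
by apply: regular_prod => i; apply: regular_exp.
Qed.

Lemma regular_mulmx m p q (A : SL K n -> 'M[K]_(m, p)) (B : SL K n -> 'M[K]_(p, q)) :
  (forall i j, regular_SL (fun g => A g i j)) ->
  (forall i j, regular_SL (fun g => B g i j)) ->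
  forall i j, regular_SL (fun g => (A g *m B g) i j).
Proof.
move=> HA HB i j.
apply: (@eq_regular (fun g => \sum_k A g i k * B g k j)).
  by move=> g; rewrite mxE.
by apply: regular_sum => k; apply: regular_mul.
Qed.

Lemma regular_comp_SL (phi : SL K n -> SL K n) f :
  (forall i j, regular_SL (fun g => val (phi g) i j)) ->
  regular_SL f -> regular_SL (fun g => f (phi g)).
Proof.
move=> Hphi /regular_SLP[P HP].
apply: (@eq_regular (fun g => mpoly.meval (GL_coord (val (phi g))) P)).
  by move=> g; rewrite HP.
apply: regular_meval => i; rewrite /GL_coord.
case: (split_ordP i) => k -> /=.
  case/mxvec_indexP: k => a b.
  apply: eq_regular (Hphi a b) => g.
  by rewrite row_mxEl mxvecE.
apply: eq_regular (regular_cst 1) => g.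
by rewrite row_mxEr (eqP (valP (phi g))) !mxE ord1 eqxx invr1.
Qed.

End Closure.

Definition is_regular (K : numFieldType) (n : nat) : {pred SL K n -> K} :=
  fun f => `[< regular_SL f >].

(* The coordinate ring of SL(n), with the pointwise operations. *)
Record regfun (K : numFieldType) (n : nat) := Regfun {
  regfun_val :> SL K n -> K;
  regfun_valP : regfun_val \in @is_regular K n
}.

HB.instance Definition _ (K : numFieldType) (n : nat) :=
  [isSub for @regfun_val K n].
HB.instance Definition _ (K : numFieldType) (n : nat) :=
  [Choice of regfun K n by <:].

Section RegularAlgebra.
Variables (K : numFieldType) (n : nat).

Lemma is_regular_subring_closed : subring_closed (@is_regular K n).
Proof.
split=> [|f g /asboolP Hf /asboolP Hg|f g /asboolP Hf /asboolP Hg]; apply/asboolP.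
- exact: regular_cst.
- exact: (regular_add Hf (regular_opp Hg)).
- exact: regular_mul.
Qed.

HB.instance Definition _ := GRing.SubChoice_isSubComPzRing.Build
  (SL K n -> K) (@is_regular K n) (regfun K n) is_regular_subring_closed.

Lemma is_regular_submod_closed : submod_closed (@is_regular K n).
Proof.
split=> [|a f g /asboolP Hf /asboolP Hg]; apply/asboolP.
  exact: regular_cst.
exact: (regular_add (regular_mul (regular_cst n a) Hf) Hg).
Qed.

HB.instance Definition _ := GRing.SubZmodule_isSubLmodule.Build
  K (SL K n -> K) (@is_regular K n) (regfun K n) is_regular_submod_closed.

End RegularAlgebra.

Section Derivative.
Variable K : numFieldType.

Lemma is_derive_ext (f1 f2 : K -> K) (a d1 d2 : K) :
  f1 =1 f2 -> d1 = d2 -> is_derive a 1 f1 d1 -> is_derive a 1 f2 d2.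
Proof. by move=> /funext -> ->. Qed.

Lemma is_derive_meval N (x : 'I_N -> K -> K) (d : 'I_N -> K) (a : K)
    (P : mpoly.mpoly N K) :
  (forall i, is_derive a 1 (x i) (d i)) ->
  is_derive a 1 (fun t => mpoly.meval (x^~ t) P)
    (\sum_i mpoly.meval (x^~ a) (mpoly.mderiv i P) * d i).
Proof.
move=> Hx.
pose S (Q : mpoly.mpoly N K) := is_derive a 1 (fun t => mpoly.meval (x^~ t) Q)
    (\sum_i mpoly.meval (x^~ a) (mpoly.mderiv i Q) * d i).
have SC c : S (mpoly.mpolyC N c).
  apply: is_derive_ext (is_derive_cst (c : K) a 1) => [t|].
    by rewrite mpoly.mevalC.
  by rewrite big1 // => i _; rewrite mpoly.mderivC mpoly.meval0 mul0r.
have SX i : S (mpoly.mpolyX K (mpoly.mnm1 i)).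
  apply: is_derive_ext (Hx i) => [t|]; first by rewrite mpoly.mevalXU.
  rewrite (bigD1 i) //= mpoly.mderivX mpoly.mnm1E eqxx.
  rewrite big1 => [|j ji].
    rewrite addr0 mpoly.mevalZ mpoly.mevalX big1 ?mulr1 ?mul1r // => k _.
    by rewrite mpoly.mnmBE subnn expr0.
  by rewrite mpoly.mderivX mpoly.mnm1E eq_sym (negbTE ji) scale0r mpoly.meval0 mul0r.
have SD Q1 Q2 : S Q1 -> S Q2 -> S (Q1 + Q2).
  move=> H1 H2; apply: is_derive_ext (is_deriveD H1 H2) => [t|].
    by rewrite mpoly.mevalD.
  rewrite -big_split; apply: eq_bigr => i _.
  by rewrite mpoly.mderivD mpoly.mevalD mulrDl.
have SM Q1 Q2 : S Q1 -> S Q2 -> S (Q1 * Q2).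
  move=> H1 H2; apply: is_derive_ext (is_deriveM H1 H2) => [t|].
    by rewrite mpoly.mevalM.
  rewrite /GRing.scale/= !mulr_sumr -big_split; apply: eq_bigr => i _ /=.
  rewrite mpoly.mderivM mpoly.mevalD !mpoly.mevalM mulrDl addrC.
  by congr (_ + _); rewrite ?mulrA // [X in X * _ = _]mulrC.
suff : S P by apply.
rewrite [P]mpoly.mpolyE; apply: (big_ind S) => [||m _].
- by rewrite -(mpoly.mpolyC0 N K); exact: SC.
- exact: SD.
rewrite -mpoly.mul_mpolyC; apply: (SM _ _ (SC _)); rewrite mpoly.mpolyXE_id.
apply: (big_ind S) => [||i _]; [exact: SC | exact: SM |].
elim: (m i) => [|k IH]; first by rewrite expr0; exact: SC.
by rewrite exprS; exact: SM.
Qed.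

Variable n : nat.
Implicit Types (M V : 'M[K]_n).

Let detP : mpoly.mpoly (n * n) K :=
  \det (\matrix_(i < n, j < n) mpoly.mpolyX K (mpoly.mnm1 (mxvec_index i j))).

Lemma meval_detP M : mpoly.meval (mxvec M 0) detP = \det M.
Proof.
rewrite /detP -det_map_mx; congr (\det _); apply/matrixP => i j.
by rewrite !mxE /= mpoly.mevalXU mxvecE.
Qed.

Let ddet M V : K :=
  \sum_i mpoly.meval (mxvec M 0) (mpoly.mderiv i detP) * mxvec V 0 i.

Lemma is_derive_line (a b : K) : is_derive (0 : K) 1 (fun t : K => a + t * b) b.
Proof.
apply: is_derive_ext (is_deriveD (is_derive_cst (a : K) (0 : K) 1)
  (is_deriveM (is_derive_id (0 : K) 1) (is_derive_cst (b : K) (0 : K) 1))) => [t //|].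
by rewrite scale0r /GRing.scale /= mulr1 !add0r.
Qed.

Lemma is_derive_det M V :
  is_derive (0 : K) 1 (fun t : K => \det (M + t *: V)) (ddet M V).
Proof.
have H i : is_derive (0 : K) 1 (fun t : K => mxvec (M + t *: V) 0 i) (mxvec V 0 i).
  apply: is_derive_ext (is_derive_line (mxvec M 0 i) (mxvec V 0 i)) => // t.
  by rewrite linearD linearZ !mxE.
apply: is_derive_ext (is_derive_meval detP H) => [t|].
  exact: meval_detP.
by rewrite scale0r addr0.
Qed.

Let dcoord M V (i : 'I_(n * n + 1)) : K :=
  row_mx (mxvec V) (- (\det M) ^- 2 * ddet M V)%:M 0 i.

Lemma is_derive_coord M V i : \det M != 0 ->
  is_derive (0 : K) 1 (fun t : K => GL_coord (M + t *: V) i) (dcoord M V i).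
Proof.
move=> M0; case: (split_ordP i) => k -> ; rewrite /dcoord /GL_coord.
  rewrite row_mxEl.
  apply: is_derive_ext (is_derive_line (mxvec M 0 k) (mxvec V 0 k)) => // t.
  by rewrite row_mxEl linearD linearZ !mxE.
rewrite row_mxEr ord1 mxE eqxx mulr1n.
have [dM eM] := is_derive_det M V.
have M0' : \det (M + 0 *: V) != 0 by rewrite scale0r addr0.
apply: (@is_derive_ext (fun t => (\det (M + t *: V))^-1) _ _ _ _ _ erefl).
  by move=> t; rewrite row_mxEr mxE eqxx.
apply: DeriveDef; first exact: derivableV.
by rewrite deriveV // eM scale0r addr0.
Qed.

Let dpoly (P : mpoly.mpoly (n * n + 1) K) M V : K :=
  \sum_i mpoly.meval (GL_coord M) (mpoly.mderiv i P) * dcoord M V i.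

Lemma is_derive_GL (F : 'M[K]_n -> K) P M V :
  (forall M, M \in unitmx -> F M = mpoly.meval (GL_coord M) P) ->
  M \in unitmx ->
  is_derive (0 : K) 1 (fun t : K => F (M + t *: V)) (dpoly P M V).
Proof.
move=> HF; rewrite unitmxE unitfE => M0.
have H := is_derive_meval P (fun i => is_derive_coord V i M0).
have {H} : is_derive (0 : K) 1
    (fun t : K => mpoly.meval (GL_coord (M + t *: V)) P) (dpoly P M V).
  by apply: is_derive_ext H => //; rewrite scale0r addr0.
apply: near_eq_is_derive.
have [dM eM] := is_derive_det M V.
have /derivable1_diffP/differentiable_continuous cM := dM.
have M0' : \det (M + 0 *: V) != 0 by rewrite scale0r addr0.
near=> t.
rewrite HF // unitmxE unitfE.
by near: t; exact: (cvgr_neq0 (\det (M + 0 *: V))).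
Unshelve. all: by end_near. Qed.

Let dpoly_linear P M (I : Type) (r : seq I) (c : I -> K) (V : I -> 'M[K]_n) :
  dpoly P M (\sum_(k <- r) c k *: V k) = \sum_(k <- r) c k * dpoly P M (V k).
Proof.
have ddetE : ddet M (\sum_(k <- r) c k *: V k) = \sum_(k <- r) c k * ddet M (V k).
  rewrite /ddet; under [RHS]eq_bigr => k _ do rewrite mulr_sumr.
  rewrite exchange_big; apply: eq_bigr => i _ /=.
  rewrite (linear_sum mxvec) summxE mulr_sumr; apply: eq_bigr => k _.
  by rewrite linearZ mxE mulrCA.
have dcoordE i :
    dcoord M (\sum_(k <- r) c k *: V k) i = \sum_(k <- r) c k * dcoord M (V k) i.
  rewrite /dcoord; case: (split_ordP i) => j -> .
    rewrite row_mxEl linear_sum summxE; apply: eq_bigr => k _.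
    by rewrite linearZ mxE row_mxEl.
  rewrite row_mxEr ord1 mxE eqxx mulr1n ddetE mulr_sumr; apply: eq_bigr => k _.
  by rewrite row_mxEr mxE eqxx mulr1n mulrCA.
rewrite /dpoly; under [RHS]eq_bigr => k _ do rewrite mulr_sumr.
rewrite exchange_big; apply: eq_bigr => i _ /=.
rewrite dcoordE mulr_sumr; apply: eq_bigr => k _.
by rewrite mulrCA.
Qed.

Lemma regular_derive1 (F : 'M[K]_n -> K) (V : SL K n -> 'M[K]_n) :
  regular_GL F -> (forall i j, regular_SL (fun g => V g i j)) ->
  regular_SL (fun g => derive1 (fun t : K => F (val g + t *: V g)) 0).
Proof.
move=> [P HP] HV.
apply: (@eq_regular _ _ (fun g => dpoly P (val g) (V g))).
  move=> g; rewrite derive1E.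
  by have [_ ->] := is_derive_GL (V g) HP (SL_unitmx g).
have HVr k : regular_SL (fun g => mxvec (V g) 0 k).
  by case/mxvec_indexP: k => i j; apply: eq_regular (HV i j) => g; rewrite mxvecE.
have Hent k : regular_SL (fun g : SL K n => mxvec (val g) 0 k).
  case/mxvec_indexP: k => i j; move: (@regular_entry K n i j).
  by apply: eq_regular => g; rewrite mxvecE.
have Hddet : regular_SL (fun g => ddet (val g) (V g)).
  by apply: regular_sum => i; apply: regular_mul => //; exact: regular_meval.
apply: regular_sum => i; apply: regular_mul.
  apply: regular_meval => k; rewrite /GL_coord; case: (split_ordP k) => l ->.
    by apply: eq_regular (Hent l) => g; rewrite row_mxEl.
  apply: eq_regular (regular_cst n 1) => g.
  by rewrite row_mxEr (eqP (valP g)) !mxE ord1 eqxx invr1.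
rewrite /dcoord; case: (split_ordP i) => l ->.
  by apply: eq_regular (HVr l) => g; rewrite row_mxEl.
apply: eq_regular (regular_opp Hddet) => g.
by rewrite row_mxEr (eqP (valP g)) ord1 mxE eqxx mulr1n expr1n invr1 mulN1r.
Qed.

Let det_trans (i j : 'I_n) (t : K) : i != j -> \det (1%:M + t *: delta_mx i j) = 1.
Proof.
wlog ij : i j / (j < i)%N => [IH ij|_].
  case: (ltngtP i j) => H; [|exact: IH|by rewrite (val_inj H) eqxx in ij].
  rewrite -det_tr linearD linearZ /= trmx1 trmx_delta; apply: IH => //.
  by rewrite eq_sym.
rewrite det_trig.
  apply: big1 => k _; rewrite !mxE eqxx.
  case: eqP => [->|_]; last by rewrite mulr0 addr0.
  by rewrite [i == j]gtn_eqF // mulr0 addr0.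
apply/is_trig_mxP => a b ab; rewrite !mxE -val_eqE (ltn_eqF ab) add0r.
case: eqP => [ai|_]; last by rewrite mulr0.
case: eqP => [bj|_]; last by rewrite mulr0.
by move: ij; rewrite -ai -bj => /ltn_trans /(_ ab); rewrite ltnn.
Qed.

Lemma derive1_indep (F1 F2 : 'M[K]_n -> K) (g : SL K n) (A : 'M[K]_n) :
  regular_GL F1 -> regular_GL F2 -> (forall h : SL K n, F1 (val h) = F2 (val h)) ->
  \tr A = 0 ->
  derive1 (fun t : K => F1 (val g + t *: (val g *m A))) 0 =
  derive1 (fun t : K => F2 (val g + t *: (val g *m A))) 0.
Proof.
move=> [P1 H1] [P2 H2] H12 trA.
pose D B := dpoly P1 (val g) (val g *m B) - dpoly P2 (val g) (val g *m B).
have derE F P B : (forall M, M \in unitmx -> F M = mpoly.meval (GL_coord M) P) ->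
    derive1 (fun t : K => F (val g + t *: (val g *m B))) 0 =
    dpoly P (val g) (val g *m B).
  move=> HP; rewrite derive1E.
  by have [_ ->] := is_derive_GL (val g *m B) HP (SL_unitmx g).
suff : D A = 0 by move=> /eqP; rewrite subr_eq0 (derE _ P1) // (derE _ P2) // => /eqP.
have Dsum (I : Type) (r : seq I) (c : I -> K) B :
    D (\sum_(k <- r) c k *: B k) = \sum_(k <- r) c k * D (B k).
  rewrite /D mulmx_sumr; under eq_bigr => k _ do rewrite -scalemxAr.
  rewrite !dpoly_linear -sumrB.
  by apply: eq_bigr => k _; rewrite mulrBr.
have Dsl B : (forall t, \det (1%:M + t *: B) = 1) -> D B = 0.
  move=> HB; apply/eqP; rewrite subr_eq0 -(derE _ _ B H1) -(derE _ _ B H2); apply/eqP.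
  congr (derive1 _ 0); apply/funext => t.
  have dt : \det (val g + t *: (val g *m B)) == 1.
    by rewrite scalemxAr -{1}[val g]mulmx1 -mulmxDr det_mulmx HB (eqP (valP g)) mulr1.
  exact: (H12 (exist (fun M : 'M[K]_n => \det M == 1) _ dt)).
have Dij i j : i != j -> D (delta_mx i j) = 0.
  by move=> ij; apply: Dsl => t; exact: det_trans.
have Dii i j : D (delta_mx i i) = D (delta_mx j j).
  have [->//|ij] := eqVneq i j.
  pose T (s : K) := 1%:M + s *: delta_mx j i : 'M[K]_n.
  have ji : j != i by rewrite eq_sym.
  pose N := T 1 *m delta_mx i j *m T (-1).
  have TT : T 1 *m T (-1) = 1%:M.
    rewrite /T scale1r scaleN1r mulmxDl mul1mx mulmxBr mulmx1.
    by rewrite mul_delta_mx_0 // subr0 subrK.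
  have N0 : D N = 0.
    apply: Dsl => t.
    have -> : 1%:M + t *: N = T 1 *m (1%:M + t *: delta_mx i j) *m T (-1).
      rewrite /N; move: (T 1) (T (-1)) TT => S S' SS.
      by rewrite mulmxDr mulmx1 mulmxDl SS -scalemxAr -scalemxAl.
    by rewrite !det_mulmx !det_trans // !mulr1.
  have NE : N = \sum_(k <- [:: (1, (i, j)); (1, (j, j)); (-1, (i, i)); (-1, (j, i))])
      (k.1 : K) *: delta_mx k.2.1 k.2.2.
    rewrite !big_cons big_nil /= addr0 !scale1r !scaleN1r /N /T scale1r scaleN1r.
    rewrite mulmxDl mul1mx mul_delta_mx mulmxDr mulmx1 mulmxN mulmxDl !mul_delta_mx.
    by rewrite opprD !addrA.
  move: N0; rewrite NE Dsum !big_cons big_nil /= addr0 (Dij i j) // (Dij j i) //.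
  by rewrite !mulr0 add0r addr0 mul1r mulN1r => /eqP; rewrite subr_eq0 => /eqP.
rewrite [A]matrix_sum_delta pair_big /= Dsum.
rewrite -(pair_big xpredT xpredT (fun i j => A i j * D (delta_mx i j))) /=.
rewrite (eq_bigr (fun i => A i i * D (delta_mx i i))); last first.
  move=> i _; rewrite (bigD1 i) //= big1 ?addr0 // => j ji.
  by rewrite Dij ?mulr0 // eq_sym.
case: (pickP 'I_n) => [i0 _|no]; last by apply: big1 => i; have := no i.
rewrite (eq_bigr (fun i => A i i * D (delta_mx i0 i0))); last first.
  by move=> i _; rewrite (Dii i i0).
by rewrite -mulr_suml -/(mxtrace A) trA mul0r.
Qed.

End Derivative.

Section Conjugation.
Variables (K : numFieldType) (n : nat).

Lemma SL_conj_subproof (x g : SL K n) :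
  \det (val x *m val g *m invmx (val x)) == 1.
Proof.
by rewrite !det_mulmx det_inv (eqP (valP x)) (eqP (valP g)) mul1r invr1 mulr1.
Qed.

Definition SL_conj (x g : SL K n) : SL K n :=
  exist _ (val x *m val g *m invmx (val x)) (SL_conj_subproof x g).

Lemma regfun_conj_subproof (x : SL K n) (f : regfun K n) :
  (fun g => f (SL_conj x g)) \in @is_regular K n.
Proof.
apply/asboolP; apply: regular_comp_SL; last exact/asboolP/regfun_valP.
apply: regular_mulmx => i j; last exact: regular_cst.
by move: i j; apply: regular_mulmx => i j; [exact: regular_cst | exact: regular_entry].
Qed.

Definition regfun_conj (x : SL K n) (f : regfun K n) : regfun K n :=
  Regfun (regfun_conj_subproof x f).

Definition class_function (c : regfun K n) : Prop :=
  forall x g, c (SL_conj x g) = c g.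

(* A regular vector field on SL(n) is a K-linear derivation of its
   coordinate ring. *)
Definition vector_field (D : regfun K n -> regfun K n) : Prop :=
  linear D /\ forall f h, D (f * h) = D f * h + f * D h.

(* Invariance under the pushforward by every conjugation of SL(n). *)
Definition conj_invariant (D : regfun K n -> regfun K n) : Prop :=
  forall x f, D (regfun_conj x f) = regfun_conj x (D f).

Definition invariant_vector_field (D : regfun K n -> regfun K n) : Prop :=
  vector_field D /\ conj_invariant D.

Record equivariant_map := EquivariantMap {
  equivariant_fun :> SL K n -> sl K n;
  equivariant_regular :
    forall i j, regular_SL (fun g => val (equivariant_fun g) i j);
  equivariant_conj : forall x g,
    val (equivariant_fun (SL_conj x g)) =
    val x *m val (equivariant_fun g) *m invmx (val x)
}.

Definition dir_derivative (Phi : SL K n -> sl K n) (F : 'M[K]_n -> K)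
    (g : SL K n) : K :=
  derive1 (fun t : K => F (val g + t *: (val g *m val (Phi g)))) 0.

(* Some extension of f to a regular function on GL(n); by tildeE below, the
   choice does not matter. *)
Definition extension (f : regfun K n) : 'M[K]_n -> K :=
  s2val (cid2 (asboolW (regfun_valP f))).

Lemma extension_regular (f : regfun K n) : regular_GL (extension f).
Proof. exact: s2valP. Qed.

Lemma extensionE (f : regfun K n) (g : SL K n) : f g = extension f (val g).
Proof. by rewrite /extension; case: cid2. Qed.

Lemma tilde_subproof (Phi : equivariant_map) (f : regfun K n) :
  dir_derivative Phi (extension f) \in @is_regular K n.
Proof.
apply/asboolP/regular_derive1; first exact: extension_regular.
apply: regular_mulmx => i j; [exact: regular_entry|exact: equivariant_regular].
Qed.

Definition tilde (Phi : equivariant_map) (f : regfun K n) : regfun K n :=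
  Regfun (tilde_subproof Phi f).

Lemma tildeE (Phi : equivariant_map) (f : regfun K n) (F : 'M[K]_n -> K)
    (g : SL K n) :
  regular_GL F -> (forall h, f h = F (val h)) ->
  tilde Phi f g = dir_derivative Phi F g.
Proof.
move=> HF fF; apply: derive1_indep => //; first exact: extension_regular.
  by move=> h; rewrite -extensionE fF.
exact/eqP/(valP (Phi g)).
Qed.

Definition Phi_mx (k : nat) (g : SL K n) : 'M[K]_n :=
  val g ^+ k - (n%:R^-1 * \tr (val g ^+ k))%:M.

Lemma Phi_subproof k g : \tr (Phi_mx k g) == 0.
Proof.
rewrite /Phi_mx raddfB /= mxtrace_scalar subr_eq0 -[X in _ == X]mulr_natl.
case: (posnP n) => [n0|n0].
  have -> : \tr (val g ^+ k) = 0.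
    by rewrite /mxtrace big1 // => i _; have := ltn_ord i; rewrite {2}n0.
  by rewrite !mulr0.
by rewrite mulVKf // pnatr_eq0 -lt0n.
Qed.

Lemma Phi_regular k i j : regular_SL (fun g => Phi_mx k g i j).
Proof.
have Hk : forall a b, regular_SL (fun g : SL K n => (val g ^+ k) a b).
  elim: k => [|k IH] a b; first exact: regular_cst.
  have := regular_mulmx (@regular_entry K n) IH a b.
  by apply: eq_regular => g; rewrite exprS.
apply: (@eq_regular _ _ (fun g => (val g ^+ k) i j -
   (n%:R^-1 * \sum_a (val g ^+ k) a a) * (1%:M : 'M[K]_n) i j)).
  by move=> g; rewrite !mxE mulr_natr.
apply: regular_add => //; apply/regular_opp/regular_mul/regular_cst.
by apply: regular_mul; [exact: regular_cst | exact: regular_sum].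
Qed.

Lemma Phi_conj k x g :
  Phi_mx k (SL_conj x g) = val x *m Phi_mx k g *m invmx (val x).
Proof.
have xV : invmx (val x) *m val x = 1%:M by rewrite mulVmx // SL_unitmx.
have HX : val (SL_conj x g) ^+ k = val x *m val g ^+ k *m invmx (val x).
  elim: k => [|k IH]; first by rewrite !expr0 mulmx1 mulmxV // SL_unitmx.
  rewrite !exprS IH; change (val (SL_conj x g)) with (val x *m val g *m invmx (val x)).
  rewrite -[LHS]/(_ *m _) -[val g * _]/(_ *m _).
  by rewrite -!mulmxA (mulmxA (invmx _)) xV mul1mx.
rewrite /Phi_mx HX mulmxBr mulmxBl; congr (_ - _).
rewrite mxtrace_mulC mulmxA xV mul1mx scalar_mxC -mulmxA mulmxV ?mulmx1 //.
exact: SL_unitmx.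
Qed.

Definition Phi (k : nat) : equivariant_map :=
  @EquivariantMap (fun g => exist _ (Phi_mx k g) (Phi_subproof k g))
    (Phi_regular k) (Phi_conj k).

End Conjugation.

(* Main.v *)
(** A derivation D of C[SL(n)] is determined by its velocities D(x_ij), i.e. by
    the regular map Psi : G -> M_n with (D(x_ij)(g))_ij = g Psi(g), and invariance
    of D means that Psi is equivariant. The companion matrix C(g) of the
    characteristic polynomial of g depends regularly on g and only on its
    conjugacy class. Equivariance at x = g = C(g) shows that Psi(C(g)) commutes
    with C(g), hence is a polynomial in C(g) whose coefficients c_k(g) are the
    entries of the first row of Psi(C(g)). If the first basis vector is cyclic
    for g then g is conjugate to C(g) and Psi(g) = sum_k c_k(g) g^k; such g are
    dense, so this holds everywhere. The difference of D and
    sum_(k >= 1) c_k tilde(Phi_k) then multiplies all coordinates by one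
    function e, hence the constant function \det = 1 by n e, so that e = 0. *)
Require Import Defs.
From HB Require Import structures.
From mathcomp Require Import all_boot all_order all_algebra.
From mathcomp Require Import complex reals.
From mathcomp Require Import(canonicals, coercions) mpoly.
From mathcomp Require Import perm ring.
From mathcomp Require Import boolp topology normedtype derive.
Set Implicit Arguments.
Unset Strict Implicit.
Unset Printing Implicit Defensive.
Import GRing.Theory Num.Theory.
Import numFieldNormedType.Exports.
Local Open Scope ring_scope.
Local Open Scope complex_scope.

(** * Regular functions on SL(n) and the matrix coordinates *)

Section RegularFunctions.
Variables (K : numFieldType) (n : nat).

Lemma regular_det m (A : SL K n -> 'M[K]_m) :
  (forall i j, regular_SL (fun g => A g i j)) -> regular_SL (fun g => \det (A g)).
Proof.
move=> HA; apply: regular_sum => s.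
by apply: regular_mul; [exact: regular_cst | exact: regular_prod].
Qed.

Lemma regular_adj (A : SL K n -> 'M[K]_n) :
  (forall i j, regular_SL (fun g => A g i j)) ->
  forall i j, regular_SL (fun g => (\adj (A g)) i j).
Proof.
move=> HA i j.
apply: (@eq_regular _ _ (fun g => (-1) ^+ (j + i) * \det (row' j (col' i (A g))))).
  by move=> g; rewrite mxE.
apply/regular_mul/regular_det; first exact: regular_cst.
by move=> a b; apply: eq_regular (HA (lift j a) (lift i b)) => g; rewrite !mxE.
Qed.

Lemma regular_expmx (A : SL K n -> 'M[K]_n) k :
  (forall i j, regular_SL (fun g => A g i j)) ->
  forall i j, regular_SL (fun g => (A g ^+ k) i j).
Proof.
move=> HA; elim: k => [|k IH] i j; first exact: regular_cst.
by apply: eq_regular (regular_mulmx HA IH i j) => g; rewrite exprS.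
Qed.

(** For the generic matrix [G] the coefficient is a polynomial in the entries; it specialises to the
    coefficient for [A g]. *)
Lemma regular_char_poly m (A : SL K n -> 'M[K]_m) k :
  (forall i j, regular_SL (fun g => A g i j)) ->
  regular_SL (fun g => (char_poly (A g))`_k).
Proof.
move=> HA.
pose G : 'M[mpoly.mpoly (m * m) K]_m :=
  \matrix_(i, j) mpoly.mpolyX K (mpoly.mnm1 (mxvec_index i j)).
apply: (@eq_regular _ _ (fun g => mpoly.meval (mxvec (A g) 0) (char_poly G)`_k)).
  move=> g; rewrite -coef_map map_char_poly; congr (char_poly _)`_k.
  by apply/matrixP => i j; rewrite !mxE /= mpoly.mevalXU mxvecE.
apply: regular_meval => i; case/mxvec_indexP: i => a b.
by apply: eq_regular (HA a b) => g; rewrite mxvecE.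
Qed.

Definition regfun_of (f : SL K n -> K) (Hf : regular_SL f) : regfun K n :=
  Regfun (asboolT Hf).

Definition coord (i j : 'I_n) : regfun K n := regfun_of (@regular_entry K n i j).

Lemma regfunP (f h : regfun K n) : f =1 h -> f = h.
Proof. by move=> fh; apply/val_inj/funext. Qed.

Lemma regfunD (f h : regfun K n) g : (f + h) g = f g + h g.
Proof. by []. Qed.

Lemma regfunM (f h : regfun K n) g : (f * h) g = f g * h g.
Proof. by []. Qed.

Lemma regfunZ a (f : regfun K n) g : (a *: f) g = a * f g.
Proof. by []. Qed.

Lemma regfun1 g : (1 : regfun K n) g = 1.
Proof. by []. Qed.

Lemma regfun_sum (I : Type) (r : seq I) P (F : I -> regfun K n) g :
  (\sum_(i <- r | P i) F i) g = \sum_(i <- r | P i) F i g.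
Proof. by elim/big_rec2: _ => [//|i x y _ <-]. Qed.

Lemma regfun_prod (I : Type) (r : seq I) P (F : I -> regfun K n) g :
  (\prod_(i <- r | P i) F i) g = \prod_(i <- r | P i) F i g.
Proof. by elim/big_rec2: _ => [//|i x y _ <-]. Qed.

End RegularFunctions.

(** * Tangent vectors of SL(n) as point derivations *)

Section PointDerivations.
Variables (K : numFieldType) (n : nat).
Implicit Types (p : SL K n) (E : regfun K n -> K).

Definition point_derivation p E : Prop :=
  (forall a f h, E (a *: f + h) = a * E f + E h) /\
  (forall f h, E (f * h) = E f * h p + f p * E h).

Lemma point_derivationD p E : point_derivation p E ->
  forall f h, E (f + h) = E f + E h.
Proof. by case=> L _ f h; rewrite -[f]scale1r L mul1r scale1r. Qed.

Lemma point_derivation0 p E : point_derivation p E -> E 0 = 0.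
Proof.
move=> /point_derivationD /(_ 0 0); rewrite addr0 => /eqP.
by rewrite -subr_eq0 opprD addNKr oppr_eq0 => /eqP.
Qed.

Lemma point_derivationZ p E : point_derivation p E ->
  forall a f, E (a *: f) = a * E f.
Proof. by move=> HE a f; rewrite -[a *: f]addr0 HE.1 (point_derivation0 HE) addr0. Qed.

Lemma point_derivation1 p E : point_derivation p E -> E 1 = 0.
Proof.
case=> _ /(_ 1 1); rewrite mulr1 regfun1 mul1r mulr1 => /eqP.
by rewrite -subr_eq0 opprD addNKr oppr_eq0 => /eqP.
Qed.

Lemma point_derivation_sum p E : point_derivation p E ->
  forall (I : Type) (r : seq I) P (F : I -> regfun K n),
  E (\sum_(i <- r | P i) F i) = \sum_(i <- r | P i) E (F i).
Proof.
move=> HE I r P F; elim/big_rec2: _ => [|i x y _ <-]; first exact: point_derivation0 HE.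
by rewrite (point_derivationD HE).
Qed.

Lemma point_derivation_sub p E1 E2 a : point_derivation p E1 ->
  point_derivation p E2 -> point_derivation p (fun f => E1 f - a * E2 f).
Proof.
move=> [L1 M1] [L2 M2]; split=> [b f h|f h].
  by rewrite L1 L2; ring.
by rewrite M1 M2; ring.
Qed.

(** By additivity and the Leibniz rule, the polynomials whose restriction to SL(n) is killed by [E]
    are closed under sums and products. The one affine coordinate that is not a matrix entry, the
    inverse determinant, restricts to the constant 1. *)
Lemma point_derivation_eq0 p E f :
  point_derivation p E -> (forall i j, E (coord K i j) = 0) -> E f = 0.
Proof.
move=> HE E0.
have Hev (P : mpoly.mpoly (n * n + 1) K) :
    regular_SL (fun g : SL K n => mpoly.meval (GL_coord (val g)) P).
  by apply/regular_SLP; exists P.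
pose ev P := regfun_of (Hev P).
pose S P := E (ev P) = 0.
have SC c : S (mpoly.mpolyC _ c).
  rewrite /S (_ : ev _ = c *: (1 : regfun K n)); last first.
    by apply: regfunP => g; rewrite regfunZ mulr1 [LHS]mpoly.mevalC.
  by rewrite (point_derivationZ HE) (point_derivation1 HE) mulr0.
have SX i : S (mpoly.mpolyX K (mpoly.mnm1 i)).
  rewrite /S; case: (split_ordP i) => k ->.
    case/mxvec_indexP: k => a b; rewrite -(E0 a b); congr E; apply: regfunP => g.
    by rewrite [LHS]mpoly.mevalXU /GL_coord row_mxEl mxvecE.
  rewrite -(point_derivation1 HE); congr E; apply: regfunP => g.
  rewrite [LHS]mpoly.mevalXU /GL_coord row_mxEr (eqP (valP g)).
  by rewrite !mxE ord1 eqxx invr1.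
have SD P Q : S P -> S Q -> S (P + Q).
  rewrite /S => HP HQ; rewrite (_ : ev _ = ev P + ev Q).
    by rewrite (point_derivationD HE) HP HQ addr0.
  by apply: regfunP => g; rewrite [LHS]mpoly.mevalD.
have SM P Q : S P -> S Q -> S (P * Q).
  rewrite /S => HP HQ; rewrite (_ : ev _ = ev P * ev Q).
    by rewrite HE.2 HP HQ mulr0 mul0r addr0.
  by apply: regfunP => g; rewrite [LHS]mpoly.mevalM.
have {SX} SP P : S P.
  rewrite [P]mpoly.mpolyE; apply: (big_ind S) => [||m _].
  - by rewrite -(mpoly.mpolyC0 _ K); exact: SC.
  - exact: SD.
  rewrite -mpoly.mul_mpolyC; apply: (SM _ _ (SC _)); rewrite mpoly.mpolyXE_id.
  apply: (big_ind S) => [||i _]; [exact: SC | exact: SM |].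
  elim: (m i) => [|k IH]; first by rewrite expr0; exact: SC.
  by rewrite exprS; exact: SM.
have /asboolP/regular_SLP[P HP] := regfun_valP f.
by rewrite -(SP P); congr E; apply: regfunP.
Qed.

Lemma point_derivation_ext p E1 E2 f :
  point_derivation p E1 -> point_derivation p E2 ->
  (forall i j, E1 (coord K i j) = E2 (coord K i j)) -> E1 f = E2 f.
Proof.
move=> H1 H2 H12; apply/eqP; rewrite -subr_eq0 -[E2 f]mul1r; apply/eqP.
apply: (point_derivation_eq0 f (point_derivation_sub 1 H1 H2)) => i j.
by rewrite H12 mul1r subrr.
Qed.

(* [E] acts on products of n coordinates, hence on [\det], as multiplication
   by n times [c], while [\det] is the constant 1 on SL(n). *)
Lemma scalar_point_derivation p E c : (0 < n)%N -> point_derivation p E ->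
  (forall i j, E (coord K i j) = c * val p i j) -> c = 0.
Proof.
move=> n_gt0 HE Ec.
have Eprod (s : 'I_n -> 'I_n) (r : seq 'I_n) :
    E (\prod_(i <- r) coord K i (s i)) =
    (size r)%:R * c * \prod_(i <- r) val p i (s i).
  elim: r => [|i r IH]; first by rewrite !big_nil (point_derivation1 HE) !mul0r.
  rewrite !big_cons HE.2 IH Ec regfun_prod /= -natr1; set X := \prod_(_ <- _) _.
  by ring.
have det1 : (1 : regfun K n) = \sum_(s : 'S_n)
    (-1) ^+ s *: \prod_(i <- enum 'I_n) coord K i (s i).
  apply: regfunP => g; rewrite regfun1 regfun_sum -[LHS](eqP (valP g)).
  by apply: eq_bigr => s _; rewrite regfunZ regfun_prod big_enum.
have := point_derivation1 HE; rewrite det1 (point_derivation_sum HE).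
rewrite (eq_bigr (fun s : 'S_n => n%:R * c *
    ((-1) ^+ s * \prod_i val p i (s i)))) => [|s _].
  rewrite -mulr_sumr -/(\det (val p)) (eqP (valP p)) mulr1 => /eqP.
  by rewrite mulf_eq0 pnatr_eq0 -leqn0 leqNgt n_gt0 => /eqP.
rewrite (point_derivationZ HE) Eprod -cardE card_ord big_enum /=.
by rewrite mulrCA.
Qed.

Lemma vector_field_point (D : regfun K n -> regfun K n) p :
  vector_field D -> point_derivation p (fun f => D f p).
Proof.
by move=> [L M]; split=> [a f h|f h]; [rewrite L | rewrite M].
Qed.

End PointDerivations.

(** * Invariance of the fields [tilde Psi] *)

Section TildeInvariant.
Variables (K : numFieldType) (n : nat).

Lemma regular_GL_derivable (F : 'M[K]_n -> K) (g : SL K n) (V : 'M[K]_n) :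
  regular_GL F -> derivable (fun t : K => F (val g + t *: V)) 0 1.
Proof. by case=> P HP; case: (is_derive_GL V HP (SL_unitmx g)). Qed.

Lemma regular_GL_entry i j : regular_GL (fun M : 'M[K]_n => M i j).
Proof.
exists (mpoly.mpolyX K (mpoly.mnm1 (lshift 1 (mxvec_index i j)))) => M _.
by rewrite mpoly.mevalXU /GL_coord row_mxEl mxvecE.
Qed.

Variable Psi : equivariant_map K n.

(** The chosen [extension] is neither linear nor multiplicative in its argument. By [tildeE], the
    combination or product of the extensions of [f] and [h] may be differentiated instead. *)
Lemma tilde_vector_field : vector_field (tilde Psi).
Proof.
split=> [a f h|f h]; apply: regfunP => g.
  have [P HP] := extension_regular f; have [Q HQ] := extension_regular h.
  rewrite (@tildeE _ _ _ _ (fun M => a * extension f M + extension h M)).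
  - rewrite regfunD regfunZ /= /dir_derivative !derive1E.
    have df := @regular_GL_derivable _ g (val g *m val (Psi g)) (extension_regular f).
    have dh := @regular_GL_derivable _ g (val g *m val (Psi g)) (extension_regular h).
    rewrite deriveD //; last exact: derivableZ.
    by rewrite deriveZ.
  - exists (mpoly.mpolyC _ a * P + Q) => M uM.
    by rewrite mpoly.mevalD mpoly.mevalM mpoly.mevalC HP ?HQ.
  - by move=> k; rewrite regfunD regfunZ !extensionE.
have [P HP] := extension_regular f; have [Q HQ] := extension_regular h.
rewrite (@tildeE _ _ _ _ (fun M => extension f M * extension h M)).
- rewrite regfunD !regfunM /= /dir_derivative !derive1E.
  have df := @regular_GL_derivable _ g (val g *m val (Psi g)) (extension_regular f).
  have dh := @regular_GL_derivable _ g (val g *m val (Psi g)) (extension_regular h).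
  rewrite deriveM // scale0r addr0 -!extensionE addrC mulrC.
  by congr (_ + _).
- by exists (P * Q) => M uM; rewrite mpoly.mevalM HP ?HQ.
- by move=> k; rewrite regfunM !extensionE.
Qed.

Lemma tilde_coord i j g : tilde Psi (coord K i j) g = (val g *m val (Psi g)) i j.
Proof.
rewrite (tildeE _ _ (@regular_GL_entry i j)) // /dir_derivative derive1E.
have [_ <-] := is_derive_line (val g i j) ((val g *m val (Psi g)) i j).
by congr derive; apply/funext => t; rewrite !mxE.
Qed.

Lemma regfun_conj_coord (x : SL K n) i j :
  regfun_conj x (coord K i j) =
  \sum_a \sum_b (val x i a * invmx (val x) b j) *: coord K a b.
Proof.
apply: regfunP => g; rewrite regfun_sum [LHS]mxE.
under eq_bigr => b _ do rewrite mxE mulr_suml.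
rewrite exchange_big; apply: eq_bigr => a _ /=.
rewrite regfun_sum; apply: eq_bigr => b _.
by rewrite regfunZ /= mulrAC.
Qed.

Lemma vector_field_conj_coord (D : regfun K n -> regfun K n) x i j g :
  vector_field D ->
  D (regfun_conj x (coord K i j)) g =
  (val x *m (\matrix_(a, b) D (coord K a b) g) *m invmx (val x)) i j.
Proof.
move=> vfD; have HD := vector_field_point g vfD.
rewrite regfun_conj_coord (point_derivation_sum HD) [RHS]mxE.
under [RHS]eq_bigr => b _ do rewrite mxE mulr_suml.
rewrite [RHS]exchange_big; apply: eq_bigr => a _ /=.
rewrite (point_derivation_sum HD); apply: eq_bigr => b _.
by rewrite (point_derivationZ HD) mxE mulrAC.
Qed.

(** Both sides of the invariance equation, evaluated at [g], are point derivations at [SL_conj x g],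
    so comparing them on coordinates suffices. *)
Lemma tilde_invariant : invariant_vector_field (tilde Psi).
Proof.
split=> [|x f]; first exact: tilde_vector_field.
have vf := tilde_vector_field.
apply: regfunP => g.
have conjD a (h k : regfun K n) :
    regfun_conj x (a *: h + k) = a *: regfun_conj x h + regfun_conj x k.
  exact: regfunP.
have conjM (h k : regfun K n) :
    regfun_conj x (h * k) = regfun_conj x h * regfun_conj x k.
  exact: regfunP.
apply: (@point_derivation_ext _ _ (SL_conj x g)
  (fun f => tilde Psi (regfun_conj x f) g) (fun f => tilde Psi f (SL_conj x g))).
- have [L M] := vector_field_point g vf.
  split=> [a h k|h k]; first by rewrite conjD; apply: L.
  by rewrite conjM; apply: M.
- exact: vector_field_point.
move=> i j; rewrite (vector_field_conj_coord _ _ _ _ vf) tilde_coord equivariant_conj.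
congr (fun_of_matrix _ i j).
rewrite !mulmxA mulmxKV ?SL_unitmx // -!mulmxA; congr (_ *m _).
rewrite mulmxA; congr (_ *m _).
by apply/matrixP => a b; rewrite mxE tilde_coord.
Qed.

End TildeInvariant.

(** * Density of the nonvanishing locus of a regular function *)

Section Density.
Variable K : numFieldType.

(** In characteristic zero the first [size p] natural numbers are distinct roots, too many for a
    nonzero [p]. *)
Lemma poly_vanishing (p : {poly K}) : (forall t, p.[t] = 0) -> p = 0.
Proof.
move=> p0; apply/eqP/negP => /negP pn0.
have := @max_poly_roots _ p [seq i%:R | i <- iota 0 (size p)] pn0.
rewrite size_map size_iota ltnn => H; suff : false by [].
apply: H; first by apply/allP => t _; rewrite /root p0.
by rewrite map_inj_uniq ?iota_uniq // => i j /eqP; rewrite eqr_nat => /eqP.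
Qed.

(** Membership in the localisation of the polynomials at [d]; the values of [f] at roots of [d] are
    left free. *)
Definition rational_with_denominator (d : {poly K}) (f : K -> K) : Prop :=
  exists m (p : {poly K}), forall t, d.[t] != 0 -> f t * d.[t] ^+ m = p.[t].

Variable d : {poly K}.
Local Notation rational := (rational_with_denominator d).

Lemma rational_poly (p : {poly K}) : rational (fun t => p.[t]).
Proof. by exists 0, p => t _; rewrite mulr1. Qed.

Lemma rational_inv : rational (fun t => d.[t]^-1).
Proof. by exists 1, 1 => t dt; rewrite expr1 mulVf // hornerC. Qed.

Lemma rational_mul f h : rational f -> rational h -> rational (fun t => f t * h t).
Proof.
move=> [m [p Hp]] [k [q Hq]]; exists (m + k)%N, (p * q) => t dt.
by rewrite hornerM -Hp // -Hq // exprD mulrACA.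
Qed.

Lemma rational_add f h : rational f -> rational h -> rational (fun t => f t + h t).
Proof.
move=> [m [p Hp]] [k [q Hq]]; exists (m + k)%N, (p * d ^+ k + q * d ^+ m) => t dt.
by rewrite !hornerE -Hp // -Hq // exprD; ring.
Qed.

Lemma eq_rational f h : (forall t, d.[t] != 0 -> f t = h t) ->
  rational f -> rational h.
Proof. by move=> fh [m [p Hp]]; exists m, p => t dt; rewrite -fh // Hp. Qed.

Lemma rational_meval N (x : K -> 'I_N -> K) (P : mpoly.mpoly N K) :
  (forall i, rational (fun t => x t i)) -> rational (fun t => mpoly.meval (x t) P).
Proof.
move=> Hx; apply: (@eq_rational (fun t =>
  \sum_(m <- mpoly.msupp P) mpoly.mcoeff m P * \prod_i x t i ^+ m i)).
  by move=> t _; rewrite mpoly.mevalE.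
have Hcst c : rational (fun=> c).
  by apply: eq_rational (rational_poly c%:P) => t _; rewrite hornerC.
elim: (mpoly.msupp P) => [|m r IH].
  by apply: eq_rational (Hcst 0) => t _; rewrite big_nil.
apply: eq_rational (rational_add (rational_mul (Hcst (mpoly.mcoeff m P)) _) IH) => [t _|].
  by rewrite big_cons.
elim: (index_enum _) => [|i s IHs].
  by apply: eq_rational (Hcst 1) => t _; rewrite big_nil.
apply: eq_rational (rational_mul (f := fun t => x t i ^+ m i) _ IHs) => [t _|].
  by rewrite big_cons.
elim: (m i) => [|k IHk]; first exact: Hcst.
by apply: eq_rational (rational_mul (Hx i) IHk) => t _; rewrite exprS.
Qed.

Lemma rational_regular n (gamma : K -> SL K n) f : regular_SL f ->
  (forall i j, rational (fun t => val (gamma t) i j)) ->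
  rational (fun t => f (gamma t)).
Proof.
move=> /regular_SLP[P HP] Hg.
apply: (@eq_rational (fun t => mpoly.meval (GL_coord (val (gamma t))) P)).
  by move=> t _; rewrite HP.
apply: rational_meval => i; case: (split_ordP i) => k ->.
  case/mxvec_indexP: k => a b; apply: eq_rational (Hg a b) => t _.
  by rewrite /GL_coord row_mxEl mxvecE.
apply: eq_rational (rational_poly 1) => t _.
by rewrite /GL_coord row_mxEr (eqP (valP (gamma t))) hornerC !mxE ord1 eqxx invr1.
Qed.

End Density.

(* Join [g] to [h] by the segment [g + t (h - g)] and divide the first row by
   the determinant: along this rational curve in SL(n) both functions become
   rational functions of one variable. *)
Lemma regular_SL_dense (K : numFieldType) n (h : SL K n.+1) (delta f : SL K n.+1 -> K) :
  regular_SL delta -> regular_SL f -> delta h != 0 ->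
  (forall g, delta g != 0 -> f g = 0) -> forall g, f g = 0.
Proof.
move=> Hdelta Hf h_neq0 f0 g.
pose M : 'M[{poly K}]_n.+1 :=
  \matrix_(i, j) ((val g i j)%:P + (val h i j - val g i j) *: 'X).
pose d := \det M.
pose Mt t := map_mx (horner_eval t) M.
have dE t : d.[t] = \det (Mt t) by rewrite det_map_mx.
have MtE t i j : Mt t i j = val g i j + (val h i j - val g i j) * t.
  by rewrite !mxE /horner_eval !hornerE.
pose s t : 'rV[K]_n.+1 := \row_i (if i == ord0 then d.[t]^-1 else 1).
pose N t := diag_mx (s t) *m Mt t.
have detN t : d.[t] != 0 -> \det (N t) == 1.
  move=> dt; rewrite det_mulmx det_diag -dE big_ord_recl big1 => [|i _].
    by rewrite mxE eqxx mulr1 mulVf.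
  by rewrite mxE.
pose gamma t : SL K n.+1 := insubd g (N t).
have gammaE t : d.[t] != 0 -> val (gamma t) = N t.
  by move=> dt; rewrite val_insubd detN.
have Hgamma i j : rational_with_denominator d (fun t => val (gamma t) i j).
  apply: (@eq_rational _ _ (fun t => s t 0 i * (M i j).[t])) => [t dt|].
    by rewrite gammaE // /N mul_diag_mx !mxE.
  apply: rational_mul; last exact: rational_poly.
  case: (eqVneq i ord0) => [->|i0].
    by apply: eq_rational (rational_inv d) => t _; rewrite mxE eqxx.
  by apply: eq_rational (rational_poly d 1) => t _; rewrite mxE (negPf i0) hornerC.
have Mt0 : Mt 0 = val g by apply/matrixP => i j; rewrite MtE mulr0 addr0.
have Mt1 : Mt 1 = val h by apply/matrixP => i j; rewrite MtE mulr1 addrC subrK.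
(* Where [Mt t] already has determinant 1 the rescaling is trivial, so the curve passes through [g]
   at 0 and through [h] at 1. *)
have gammaI t k : Mt t = val k -> d.[t] = 1 /\ gamma t = k.
  move=> tk; have d1 : d.[t] = 1 by rewrite dE tk (eqP (valP k)).
  split=> //; apply: val_inj; rewrite gammaE ?d1 ?oner_eq0 // /N tk.
  apply/matrixP => i j; rewrite mul_diag_mx !mxE d1 invr1.
  by case: ifP; rewrite mul1r.
have [d0 g0] := gammaI 0 g Mt0; have [d1 g1] := gammaI 1 h Mt1.
have [m [p Hp]] := rational_regular Hf Hgamma.
have [k [q Hq]] := rational_regular Hdelta Hgamma.
have dn0 : d != 0 by apply: contra_eq_neq d0 => ->; rewrite horner0 eq_sym oner_eq0.
have qn0 : q != 0.
  apply: contraNneq h_neq0 => q0; have := Hq 1.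
  by rewrite d1 expr1n mulr1 g1 q0 horner0 oner_eq0 => ->.
(* At each [t] one factor vanishes: [d], or else [delta] on the curve and with it [q], or else [f]
   on the curve and with it [p]. Since [q] and [d] are nonzero polynomials, [p] is zero. *)
have /eqP : p * q * d = 0.
  apply: poly_vanishing => t; rewrite !hornerM.
  case: (eqVneq d.[t] 0) => [->|dt]; first by rewrite mulr0.
  rewrite -Hp // -Hq //; case: (eqVneq (delta (gamma t)) 0) => [->|e].
    by rewrite mul0r mulr0 mul0r.
  by rewrite f0 // !mul0r.
rewrite !mulf_eq0 (negPf dn0) (negPf qn0) !orbF => /eqP p0.
by have := Hp 0; rewrite d0 expr1n mulr1 g0 p0 horner0 oner_eq0 => ->.
Qed.

(** * Companion and Krylov matrices *)

Section Companion.
Variables (R : comNzRingType) (m : nat).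
Implicit Types A C Z : 'M[R]_m.+1.

(** The coefficients fill the last row because matrices act here on row vectors from the right. *)
Definition companion A : 'M[R]_m.+1 := \matrix_(i, j)
  if i == m :> nat then - (char_poly A)`_j else (i.+1 == j :> nat)%:R.

(** Over a field, invertible exactly when the first basis row vector is cyclic for [A]. *)
Definition krylov A : 'M[R]_m.+1 := \matrix_i row 0 (A ^+ i).

Lemma expmx_char_poly A :
  A ^+ m.+1 = - \sum_(j < m.+1) (char_poly A)`_j *: A ^+ j.
Proof.
apply/eqP; rewrite -addr_eq0; apply/eqP; rewrite -[RHS](Cayley_Hamilton A).
have eX k : horner_mx A 'X^k = A ^+ k by rewrite rmorphXn /= horner_mx_X.
rewrite -[in RHS](coefK (char_poly A)) poly_def linear_sum /= size_char_poly.
rewrite [RHS]big_ord_recr /= horner_mxZ eX addrC; congr (_ + _).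
  have /monicP := char_poly_monic A.
  by rewrite /lead_coef size_char_poly /= => ->; rewrite scale1r.
by apply: eq_bigr => j _; rewrite horner_mxZ eX.
Qed.

(** Multiplication by [A] shifts the rows by one, and Cayley-Hamilton expresses the new last row
    through the old rows. *)
Lemma mulmx_krylov A : krylov A *m A = companion A *m krylov A.
Proof.
apply/row_matrixP => i; rewrite row_mul rowK -row_mul -[_ *m A]exprSr.
rewrite row_mul; case: (eqVneq (i : nat) m) => [im|im].
  rewrite im expmx_char_poly linearN linear_sum mulmx_sum_row -sumrN.
  apply: eq_bigr => j _.
  by rewrite linearZ /= rowK !mxE im eqxx scaleNr.
have im' : (i.+1 < m.+1)%N by rewrite ltnS ltn_neqAle im -ltnS ltn_ord.
rewrite mulmx_sum_row (bigD1 (Ordinal im')) //= big1 => [|j ji].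
  by rewrite addr0 !mxE (negPf im) eqxx scale1r rowK.
rewrite !mxE (negPf im) eq_sym; move: ji; rewrite -val_eqE /= => /negPf ->.
by rewrite scale0r.
Qed.

Lemma krylov_companion A : krylov (companion A) = 1%:M.
Proof.
apply/row_matrixP => -[i lt_i]; rewrite rowK row1 /=.
elim: i lt_i => [|i IH] lt_i; first by rewrite expr0 row1; congr delta_mx; exact: val_inj.
rewrite exprSr row_mul (IH (ltnW lt_i)) -rowE; apply/rowP => j; rewrite !mxE /=.
by rewrite ltn_eqF // -val_eqE eq_sym.
Qed.

(** The hypothesis makes row 0 of [C ^+ i] the [i]-th unit vector, so row [i] of a matrix commuting
    with [C] is its row 0 times [C ^+ i]. Both sides commute with [C] and have the same row 0. *)
Lemma commute_krylov1 C Z : krylov C = 1%:M -> Z *m C = C *m Z ->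
  Z = \sum_k Z 0 k *: C ^+ k.
Proof.
move=> C1 ZC; set W := \sum_k _.
have rowX (i : 'I_m.+1) : row 0 (C ^+ i) = delta_mx 0 i by rewrite -row1 -C1 rowK.
have commX Y i : Y *m C = C *m Y -> Y *m C ^+ i = C ^+ i *m Y.
  by move=> YC; exact: (commrX i YC).
have rowE' Y i : Y *m C = C *m Y -> row i Y = row 0 Y *m C ^+ i.
  by move=> YC; rewrite [LHS]rowE -rowX -!row_mul commX.
have WC : W *m C = C *m W.
  rewrite mulmx_suml mulmx_sumr; apply: eq_bigr => k _.
  by rewrite -scalemxAl -scalemxAr -[_ *m C]exprSr -[C *m _]exprS.
apply/row_matrixP => i; rewrite (rowE' Z) // (rowE' W) //; congr (_ *m _).
rewrite linear_sum /= {1}[row 0 Z]row_sum_delta; apply: eq_bigr => k _.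
by rewrite linearZ /= rowX mxE.
Qed.

Lemma char_poly_conj A B : A *m B = 1%:M ->
  forall Z, char_poly (A *m Z *m B) = char_poly Z.
Proof.
move=> AB Z; pose f (M : 'M[R]_m.+1) := map_mx (@polyC R) M.
have fAB : f A *m f B = 1%:M by rewrite /f -map_mxM AB map_mx1.
rewrite /char_poly (_ : char_poly_mx _ = f A *m char_poly_mx Z *m f B).
  by rewrite !det_mulmx mulrAC -det_mulmx fAB det1 mul1r.
rewrite /char_poly_mx mulmxBr mulmxBl scalar_mxC -[_ *m f A *m f B]mulmxA fAB mulmx1.
by rewrite /f !map_mxM.
Qed.

Lemma companion_conj A B : A *m B = 1%:M ->
  forall Z, companion (A *m Z *m B) = companion Z.
Proof. by move=> AB Z; apply/matrixP => i j; rewrite !mxE char_poly_conj. Qed.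

(* The unipotent Jordan block: its Krylov matrix is Pascal's triangle. *)
Definition jordan1 : 'M[R]_m.+1 :=
  \matrix_(i, j) ((i == j)%:R + (i.+1 == j :> nat)%:R).

(** Right multiplication by [jordan1] adds to each entry its left neighbour, which is Pascal's
    rule. *)
Lemma jordan1_exp k (j : 'I_m.+1) : (jordan1 ^+ k) 0 j = 'C(k, j)%:R.
Proof.
elim: k j => [|k IH] j; first by rewrite expr0 mxE -val_eqE /= bin0n eq_sym.
rewrite exprSr mxE; under eq_bigr => l _ do rewrite IH mxE mulrDr.
rewrite big_split /= (bigD1 j) //= eqxx mulr1 [X in _ + X + _]big1 ?addr0; last first.
  by move=> l /negPf ->; rewrite mulr0.
case: j => -[|j] lt_j /=.
  by rewrite !bin0 big1 ?addr0 // => l _; rewrite mulr0.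
rewrite (bigD1 (Ordinal (ltnW lt_j))) //= eqxx mulr1 big1 ?addr0 ?binS ?natrD //.
by move=> l; rewrite -val_eqE /= eqSS => /negPf ->; rewrite mulr0.
Qed.

Lemma det_krylov_jordan1 : \det (krylov jordan1) = 1.
Proof.
rewrite det_trig => [|].
  by rewrite big1 // => i _; rewrite !mxE jordan1_exp binn.
by apply/is_trig_mxP => i j ij; rewrite !mxE jordan1_exp bin_small.
Qed.

Lemma det_jordan1 : \det jordan1 = 1.
Proof.
rewrite -det_tr det_trig => [|].
  by rewrite big1 // => i _; rewrite !mxE eqxx gtn_eqF // addr0.
apply/is_trig_mxP => i j ij; rewrite !mxE -val_eqE (gtn_eqF ij).
by rewrite (gtn_eqF (ltn_trans ij (ltnSn j))) addr0.
Qed.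

End Companion.

(** * The companion matrix as a regular map from SL(n) to itself *)

Section CompanionSection.
Variables (K : numFieldType) (m : nat).
Local Notation n := m.+1.

Lemma regular_krylov (i j : 'I_n) : regular_SL (fun g : SL K n => krylov (val g) i j).
Proof.
apply: (@eq_regular _ _ (fun g => (val g ^+ i) 0 j)); first by move=> g; rewrite !mxE.
exact: (regular_expmx i (@regular_entry K n)).
Qed.

Lemma regular_companion (i j : 'I_n) :
  regular_SL (fun g : SL K n => companion (val g) i j).
Proof.
case: (boolP (i == m :> nat)) => im; last first.
  apply: eq_regular (regular_cst n (i.+1 == j :> nat)%:R) => g.
  by rewrite mxE (negPf im).
apply: eq_regular (regular_opp (regular_char_poly j (@regular_entry K n))) => g.
by rewrite mxE im.
Qed.

(** The Krylov determinant is a regular function taking the value 1 at [jordan1]. *)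
Lemma cyclic_dense (f : SL K n -> K) : regular_SL f ->
  (forall g, krylov (val g) \in unitmx -> f g = 0) -> forall g, f g = 0.
Proof.
move=> Hf f0.
have det1 : \det (jordan1 K m) == 1 by rewrite det_jordan1.
pose h : SL K n := exist (fun M : 'M[K]_n => \det M == 1) _ det1.
apply: (@regular_SL_dense K m h (fun g => \det (krylov (val g)))) => //.
- exact: (regular_det regular_krylov).
- by rewrite det_krylov_jordan1 oner_neq0.
- by move=> g; rewrite -unitfE -unitmxE; exact: f0.
Qed.

(** For cyclic [g], take determinants in [mulmx_krylov] and cancel that of the Krylov matrix;
    density gives the rest. *)
Lemma det_companion (g : SL K n) : \det (companion (val g)) == 1.
Proof.
rewrite -subr_eq0; apply/eqP; move: g; apply: cyclic_dense.
  apply: regular_add; first exact: (regular_det regular_companion).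
  exact: regular_cst.
move=> g; rewrite unitmxE unitfE => k_neq0; apply/eqP; rewrite subr_eq0.
have /(congr1 determinant) := mulmx_krylov (val g).
rewrite !det_mulmx (eqP (valP g)) mulrC => /(mulIf k_neq0) <-.
exact: eqxx.
Qed.

Definition SL_companion (g : SL K n) : SL K n :=
  exist (fun M : 'M[K]_n => \det M == 1) _ (det_companion g).

Lemma SL_companion_conj x g : SL_companion (SL_conj x g) = SL_companion g.
Proof.
by apply: val_inj; rewrite /= companion_conj // mulmxV // SL_unitmx.
Qed.

End CompanionSection.

(** * Equivariant matrix maps as combinations of powers *)

Section EquivariantExpansion.
Variables (K : numClosedFieldType) (m : nat).
Local Notation n := m.+1.

(** The Krylov matrix conjugates [val g] to its companion matrix. Scaling it by an [n]-th root,
    available in an algebraically closed field, brings it into SL(n) without changing the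
    conjugation. *)
Lemma cyclic_conj_companion (g : SL K n) : krylov (val g) \in unitmx ->
  exists x, SL_conj x g = SL_companion g.
Proof.
move=> uk; have d_neq0 : \det (krylov (val g)) != 0 by rewrite -unitfE -unitmxE.
pose s := n.-root (\det (krylov (val g)))^-1.
have xP : \det (s *: krylov (val g)) == 1.
  by rewrite detZ rootCK // mulVf.
exists (exist (fun M : 'M[K]_n => \det M == 1) _ xP); apply: val_inj => /=.
rewrite -scalemxAl mulmx_krylov scalemxAr mulmxK //.
by rewrite unitmxE (eqP xP) unitr1.
Qed.

Variable P : SL K n -> 'M[K]_n.
Hypothesis P_regular : forall i j, regular_SL (fun g => P g i j).
Hypothesis P_conj : forall x g,
  P (SL_conj x g) = val x *m P g *m invmx (val x).

Lemma SL_conj_expmx (x g : SL K n) k :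
  val (SL_conj x g) ^+ k = val x *m val g ^+ k *m invmx (val x).
Proof.
have ux := SL_unitmx x.
elim: k => [|k IH]; first by rewrite !expr0 mulmx1 mulmxV.
rewrite !exprSr IH -[LHS]/(_ *m (val x *m val g *m invmx (val x))).
by rewrite !mulmxA mulmxKV.
Qed.

Lemma equivariant_expansion : exists c : 'I_n -> regfun K n,
  (forall k, class_function (c k)) /\ (forall g, P g = \sum_k c k g *: val g ^+ k).
Proof.
have c_regular (k : 'I_n) : regular_SL (fun g => P (SL_companion g) 0 k).
  by apply: regular_comp_SL (P_regular 0 k); exact: regular_companion.
exists (fun k => regfun_of (c_regular k)); split=> [k x g|].
  by rewrite /= SL_companion_conj.
have PC g : P (SL_companion g) =
    \sum_k P (SL_companion g) 0 k *: companion (val g) ^+ k.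
  apply: commute_krylov1; first exact: krylov_companion.
  (* Conjugation by [C] fixes [C], so equivariance says that [P C] commutes with [C]. *)
  set C := SL_companion g; have CC : SL_conj C C = C.
    by apply: val_inj; rewrite /= mulmxK //; exact: SL_unitmx C.
  by rewrite -{1}CC P_conj -[companion _]/(val C) mulmxKV //; exact: SL_unitmx C.
suff H i j g : P g i j - (\sum_k P (SL_companion g) 0 k *: val g ^+ k) i j = 0.
  move=> g; apply/matrixP => i j; apply/eqP; rewrite -subr_eq0; apply/eqP.
  exact: H.
move: g; apply: cyclic_dense.
  apply/regular_add/regular_opp => //.
  apply: (@eq_regular _ _ (fun g =>
    \sum_k P (SL_companion g) 0 k * (val g ^+ k) i j)).
    by move=> g; rewrite summxE; apply: eq_bigr => k _; rewrite mxE.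
  apply: regular_sum => k; apply: regular_mul => //.
  exact: (regular_expmx k (@regular_entry K n)).
move=> g /cyclic_conj_companion[x xg]; have ux := SL_unitmx x.
apply/eqP; rewrite subr_eq0; apply/eqP; congr (fun_of_matrix _ i j).
(* Conjugating both sides by [x] moves the claim to the companion matrix, where [PC] applies. *)
apply: (can_inj (mulKmx ux)); apply: (can_inj (mulmxK (_ : invmx (val x) \in unitmx))).
  by rewrite unitmx_inv.
rewrite -P_conj xg {1}PC mulmx_sumr mulmx_suml; apply: eq_bigr => k _.
by rewrite -scalemxAr -scalemxAl -SL_conj_expmx xg.
Qed.

End EquivariantExpansion.

(** * Expansion of an invariant vector field *)

Section Generators.
Variables (K : numClosedFieldType) (m : nat).
Local Notation n := m.+1.

Lemma point_derivation_lincomb (I : Type) (r : seq I) (a : I -> K)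
    (E : I -> regfun K n -> K) p : (forall i, point_derivation p (E i)) ->
  point_derivation p (fun f => \sum_(i <- r) a i * E i f).
Proof.
move=> HE; split=> [b f h|f h].
  rewrite mulr_sumr -big_split; apply: eq_bigr => i _ /=.
  by rewrite (HE i).1; ring.
rewrite mulr_suml mulr_sumr -big_split; apply: eq_bigr => i _ /=.
by rewrite (HE i).2; ring.
Qed.

Lemma adj_SL (g : SL K n) : \adj (val g) = invmx (val g).
Proof. by rewrite /invmx SL_unitmx (eqP (valP g)) invr1 scale1r. Qed.

Variable D : regfun K n -> regfun K n.
Hypothesis D_inv : invariant_vector_field D.

Definition velocity (g : SL K n) : 'M[K]_n := \matrix_(i, j) D (coord K i j) g.

(** The left-trivialised field. The adjugate replaces the inverse, with which it agrees on SL(n),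
    because its entries are polynomial in those of [g]. *)
Definition left_velocity (g : SL K n) : 'M[K]_n := \adj (val g) *m velocity g.

Lemma left_velocityK g : val g *m left_velocity g = velocity g.
Proof. by rewrite /left_velocity adj_SL mulKVmx // SL_unitmx. Qed.

Lemma left_velocity_regular i j : regular_SL (fun g => left_velocity g i j).
Proof.
move: i j; apply: regular_mulmx => i j.
  exact: (regular_adj (@regular_entry K n)).
apply: (@eq_regular _ _ (D (coord K i j))); first by move=> g; rewrite mxE.
exact/asboolP/regfun_valP.
Qed.

(** Invariance of [D], tested on the coordinates, makes [velocity] equivariant; left division by
    [val g] preserves this. *)
Lemma left_velocity_conj x g :
  left_velocity (SL_conj x g) = val x *m left_velocity g *m invmx (val x).
Proof.
have [vfD cD] := D_inv; have ux := SL_unitmx x.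
have velocity_conj : velocity (SL_conj x g) = val x *m velocity g *m invmx (val x).
  apply/matrixP => i j; rewrite -(vector_field_conj_coord x i j g vfD) cD.
  by rewrite mxE.
apply: (can_inj (mulKmx (SL_unitmx (SL_conj x g)))).
rewrite left_velocityK velocity_conj -left_velocityK.
by rewrite -[val (SL_conj x g)]/(val x *m val g *m invmx (val x)) !mulmxA mulmxKV.
Qed.

Lemma invariant_vector_field_generators :
  exists c : 'I_m -> regfun K n, (forall k, class_function (c k)) /\
    (forall f, D f = \sum_(k < m) c k * tilde (Phi K n k.+1) f).
Proof.
have [c [c_class cP]] := equivariant_expansion left_velocity_regular left_velocity_conj.
(* [lift ord0 k] is the index [k + 1]: the coefficient of the identity is dropped, and the exponents
   1 to [m = n - 1] remain. *)
pose c' (k : 'I_m) := c (lift ord0 k).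
exists c'; split=> [k|f]; first exact: c_class.
apply: regfunP => g; rewrite regfun_sum.
under eq_bigr => k _ do rewrite regfunM.
have [vfD _] := D_inv.
have HF : point_derivation g (fun h => \sum_k c' k g * tilde (Phi K n k.+1) h g).
  by apply: point_derivation_lincomb => k; exact/vector_field_point/tilde_vector_field.
have HE := point_derivation_sub 1 (vector_field_point g vfD) HF.
pose tau k := n%:R^-1 * \tr (val g ^+ k).
(* The leftover multiple of the identity: the dropped coefficient plus the trace parts subtracted in
   the [Phi_k]. *)
pose e := c ord0 g + \sum_k c' k g * tau k.+1.
have Ee i j : D (coord K i j) g -
    1 * (\sum_k c' k g * tilde (Phi K n k.+1) (coord K i j) g) = e * val g i j.
  have -> : D (coord K i j) g = (val g *m left_velocity g) i j.
    by rewrite left_velocityK mxE.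
  have -> : \sum_k c' k g * tilde (Phi K n k.+1) (coord K i j) g =
      (val g *m \sum_k c' k g *: (val g ^+ k.+1 - (tau k.+1)%:M)) i j.
    rewrite mulmx_sumr summxE; apply: eq_bigr => k _.
    by rewrite tilde_coord -scalemxAr [RHS]mxE.
  rewrite cP big_ord_recl mul1r /=.
  have -> : \sum_k c' k g *: (val g ^+ k.+1 - (tau k.+1)%:M) =
      \sum_k c' k g *: val g ^+ k.+1 - (\sum_k c' k g * tau k.+1)%:M.
    rewrite (raddf_sum (@scalar_mx K n)) -sumrB; apply: eq_bigr => k _.
    by rewrite scalerBr scale_scalar_mx.
  rewrite mulmxBr mulmxDr expr0 -scalemxAr mulmx1 mul_mx_scalar !mxE.
  by rewrite /e; ring.
have e0 := scalar_point_derivation (ltn0Sn m) HE Ee.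
apply/eqP; rewrite -subr_eq0 -[X in _ - X]mul1r; apply/eqP.
by apply: (point_derivation_eq0 f HE) => i j; rewrite Ee e0 mul0r.
Qed.

End Generators.

Theorem theorem4p2 (R : realType) (n : nat) (hn : (0 < n)%N) :
  (forall k : 'I_n.-1, invariant_vector_field (tilde (Phi R[i] n k.+1))) /\
  (forall D : regfun R[i] n -> regfun R[i] n, invariant_vector_field D ->
    exists c : 'I_n.-1 -> regfun R[i] n,
      (forall k, class_function (c k)) /\
      (forall f, D f = \sum_(k < n.-1) c k * tilde (Phi R[i] n k.+1) f)).
Proof.
split=> [k|]; first exact: tilde_invariant.
case: n hn => // m _ D HD.
exact: invariant_vector_field_generators.
Qed.
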